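(* Let $a$ be a positive integer divisible by $6$. Then the circulant digraph $\mathrm{Cay}(\mathbb{Z}_{2a}; a, a+2, a+3)$ has no hamiltonian circuit.
   Context: For a natural number $n$, $\mathbb{Z}_n$ denotes the additive cyclic group of integers modulo $n$. For a set $A$ of integers, $\mathrm{Cay}(\mathbb{Z}_n; A)$ is the digraph with vertex set $\mathbb{Z}_n$ having an arc from $u$ to $u+c \pmod n$ for every $u\in\mathbb{Z}_n$ and every $c\in A$; we write $\mathrm{Cay}(\mathbb{Z}_n; c_1,c_2,c_3)$ for $\mathrm{Cay}(\mathbb{Z}_n;\{c_1,c_2,c_3\})$. A hamiltonian circuit is a directed cycle passing through every vertex exactly once. *)

(* Defs.v *)
From mathcomp Require Import all_boot all_order all_algebra.

Set Implicit Arguments.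
Unset Strict Implicit.
Unset Printing Implicit Defensive.

Import GRing.Theory.
Local Open Scope ring_scope.

(* The connection set is a finite set of integers, listed as a sequence (order
   and repetitions are immaterial). 'Z_n is the integers modulo n only for
   n > 1: 'Z_0 and 'Z_1 are both the integers modulo 2. *)
Definition Cay (n : nat) (A : seq int) : rel 'Z_n :=
  [rel u v | has (fun c : int => v == u + c%:~R) A].
Arguments Cay n A : clear implicits.

(* A directed cycle is the cyclic sequence of its pairwise distinct vertices,
   the last one having an arc back to the first. *)
Definition hamiltonian_circuit (T : finType) (e : rel T) (s : seq T) : Prop :=
  ucycle e s /\ forall x : T, x \in s.

(* Main.v *)
Require Import Defs.
From mathcomp Require Import all_boot all_order all_fingroup all_algebra.
From mathcomp Require Import ring zify.
Import GRing.Theory.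
Local Open Scope ring_scope.

(* Let h be the successor permutation of a hamiltonian circuit and c the class
   of a. Since c + c = 0, the permutation g x := h x + c has steps 0, 2 and 3,
   and the number w <= 3 of arcs of g passing over a gap between consecutive
   vertices does not depend on the gap.
   - If w <= 1, then g has no step 3: the endpoints of such a step enclose two
     consecutive fixed points of g, whose translates by c are two consecutive
     moved points (x and x + c are never both fixed, or h would swap them).
     Hence h preserves parity.
   - If w = 2, then g is translation by 2 followed by a product of disjoint
     3-cycles, hence even. But h is a 2a-cycle, hence odd, and translation by c
     is even because a is even.
   - If w = 3, then every step of h is a + 3, a multiple of 3 (as is 2a). *)

Lemma odd_transitive_perm (T : finType) (s : {perm T}) (x : T) :
  (forall y, y \in porbit s x) -> odd_perm s = ~~ odd #|T|.
Proof.
move=> s_trans; rewrite /odd_perm.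
suff ->: porbits s = [set porbit s x] by rewrite cards1 addbT.
apply/setP=> A; rewrite inE; apply/imsetP/eqP => [[y _ ->]|->]; last by exists x.
by apply/eqP; rewrite eq_porbit_mem s_trans.
Qed.

Lemma odd_perm_cube1 (T : finType) (s : {perm T}) :
  (forall x, s (s (s x)) = x) -> ~~ odd_perm s.
Proof.
move=> s3; have: odd_perm (s * (s * s))%g = false.
  by rewrite -[RHS](odd_perm1 T); congr odd_perm; apply/permP=> x; rewrite !permM perm1.
by rewrite !odd_permM addbb addbF => ->.
Qed.

(** Serves to contradict transitivity: a proper subset of the vertices that is stable under the
    circuit must be empty. *)
Lemma invariant_of_transitive (T : finType) (s : {perm T}) (x y : T) (P : pred T) :
  y \in porbit s x -> (forall z, P z -> P (s z)) -> P x -> P y.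
Proof.
case/porbitP=> i -> Ps Px; elim: i => [|i IHi]; first by rewrite expg0 perm1.
by rewrite expgSr permM Ps.
Qed.

Definition translation (R : finZmodType) (c : R) : {perm R} := perm (addIr c).

Lemma odd_translation_double (R : finZmodType) (c : R) :
  ~~ odd_perm (translation R (c + c)).
Proof.
suff ->: translation R (c + c) = (translation R c * translation R c)%g.
  by rewrite odd_permM addbb.
by apply/permP=> x; rewrite permM !permE addrA.
Qed.

Lemma natr_Zp_eq0 (n m : nat) : (1 < n)%N -> (m%:R == 0 :> 'Z_n) = (n %| m)%N.
Proof. by move=> n_gt1; rewrite -val_eqE /= val_Zp_nat. Qed.

Definition moved (n : nat) (g : {perm 'Z_n}) (x : 'Z_n) : bool := g x != x.
Definition jumps (n : nat) (g : {perm 'Z_n}) (x : 'Z_n) : bool := g x == x + 3.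

(* The number of [z] whose arc [z -> g z] passes over the gap between
   [x + 2] and [x + 3], when [g] has steps 0, 2 and 3. *)
Definition crossings (n : nat) (g : {perm 'Z_n}) (x : 'Z_n) : nat :=
  (moved n g (x + 2)%R + moved n g (x + 1)%R + jumps n g x)%N.

(** Flow conservation: each vertex has exactly one arc in and one arc out, so moving the gap past a
    vertex loses and gains equally many arcs. *)
Lemma crossingsS (n : nat) (g : {perm 'Z_n}) (x : 'Z_n) : (3 < n)%N ->
  (forall z, g z \in [:: z; z + 2; z + 3]) ->
  crossings n g (x + 1) = crossings n g x.
Proof.
move=> n_gt3 steps.
(* Since [n] exceeds 3, the steps 0, 2 and 3 are distinct modulo [n]. *)
have n0 k : (0 < k < 4)%N -> (k%:R == 0 :> 'Z_n) = false.
  move=> k_bd; rewrite natr_Zp_eq0 ?(ltn_trans _ n_gt3) //.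
  by apply/negP=> /dvdn_leq; lia.
have [z1 z2 z3] : [/\ (1 == 0 :> 'Z_n) = false, (2 == 0 :> 'Z_n) = false &
    (3 == 0 :> 'Z_n) = false].
  by split; [exact: (n0 1%N) | exact: (n0 2%N) | exact: (n0 3%N)].
have addI0 (z c : 'Z_n) : (z + c == z) = (c == 0).
  by rewrite -{2}[z]addr0 (inj_eq (addrI z)).
(* Both values of [crossings] count, besides the moved point [x + 2], the
   3-steps from [x] and [x + 1] and the possible 2-step from [x + 1] to [x + 3]:
   [out] looks at the arc leaving [x + 1], [inn] at the one entering [x + 3]. *)
have out : moved n g (x + 1) = ((g (x + 1) == x + 3)%R + jumps n g (x + 1)%R)%N :> nat.
  have x3 : x + 1 + 2 = x + 3 by ring.
  rewrite /moved /jumps -x3.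
  have := steps (x + 1); rewrite !inE => /or3P[] /eqP->; rewrite ?eqxx ?addI0 ?z2 ?z3.
  - by rewrite ![x + 1 == _]eq_sym !addI0 z2 z3.
  - rewrite (inj_eq (addrI _)) -[_ == 3]subr_eq0 -oppr_eq0.
    by rewrite (_ : - (2 - 3) = 1) ?z1 //; ring.
  - rewrite (inj_eq (addrI _)) -subr_eq0.
    by rewrite (_ : 3 - 2 = 1) ?z1 //; ring.
have inn : moved n g (x + 3) = ((g (x + 1) == x + 3)%R + jumps n g x)%N :> nat.
  have [z gz] : exists z, g z = x + 3 by exists (g^-1%g (x + 3)); rewrite permKV.
  rewrite /moved /jumps -gz !(inj_eq perm_inj) gz.
  have := steps z; rewrite gz !inE => /or3P[/eqP <-||].
  - rewrite ![x + 1 == _]eq_sym ![x == _]eq_sym eqxx addI0 z3 (inj_eq (addrI _)) -subr_eq0.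
    by rewrite (_ : 3 - 1 = 2) ?z2 //; ring.
  - have -> : x + 3 = x + 1 + 2 by ring.
    rewrite (inj_eq (addIr _)) => /eqP <-.
    by rewrite eqxx addI0 z2 [x == _]eq_sym addI0 z1.
  - by rewrite (inj_eq (addIr _)) => /eqP <-; rewrite eqxx !addI0 z1 z3.
rewrite /crossings -!addrA.
have ->: 1 + 2 = 3 :> 'Z_n by ring.
have ->: 1 + 1 = 2 :> 'Z_n by ring.
by rewrite out inn; case: (moved _ _ _); case: (_ == _); do 2!case: (jumps _ _ _).
Qed.

Lemma crossings_const (n : nat) (g : {perm 'Z_n}) (x : 'Z_n) : (3 < n)%N ->
  (forall z, g z \in [:: z; z + 2; z + 3]) ->
  crossings n g x = crossings n g 0.
Proof.
move=> n_gt3 steps; rewrite -[x]natr_Zp.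
elim: (x : nat) => [|k IHk]; first by rewrite mulr0n.
by rewrite mulrSr crossingsS.
Qed.

(* With two strands, [g] is the square of the unit translation followed by
   disjoint 3-cycles, one for each fixed point. *)
Lemma odd_two_strands (n : nat) (g : {perm 'Z_n}) : (3 < n)%N ->
  (forall z, g z \in [:: z; z + 2; z + 3]) -> crossings n g 0 = 2%N ->
  ~~ odd_perm g.
Proof.
move=> n_gt3 steps w2.
have w2x x : crossings n g x = 2%N by rewrite crossings_const.
(* Both strands have to pass over a fixed point, which is possible only by 3-steps from its two
   predecessors. *)
have fixed_next x : ~~ moved n g (x + 2) -> jumps n g x /\ jumps n g (x + 1).
  move=> fx; have := w2x x; have := w2x (x + 1); rewrite /crossings -!addrA.
  have ->: 1 + 2 = 3 :> 'Z_n by ring.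
  have ->: 1 + 1 = 2 :> 'Z_n by ring.
  by move: fx; do 5?case: (_ n g _).
have jump_cases x : jumps n g x ->
    ~~ moved n g (x + 2) || ~~ moved n g (x + 1).
  by move=> jx; have := w2x x; rewrite /crossings jx; do 2!case: (moved _ _ _).
(* The left factor acts first, so [r (z + 2) = g z]. A fixed point p of [g] yields the 3-cycle p ->
   p + 1 -> p + 2 -> p of [r]; all points outside these cycles are fixed by [r]. *)
pose r := (translation _ (- 2) * g)%g.
have -> : g = (translation _ (1 + 1) * r)%g.
  apply/permP=> x; rewrite !permM !permE; congr (g _); ring.
rewrite odd_permM (negbTE (odd_translation_double _ _)) addFb.
apply: odd_perm_cube1 => x.
have [y ->] : exists y, x = y + 2 by exists (x - 2); ring.
have rE z : r (z + 2) = g z by rewrite permM permE addrK.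
rewrite rE.
have fixE z : ~~ moved n g z -> g z = z by move/negPn/eqP.
have jE z : jumps n g z -> g z = z + 3 by move/eqP.
have := steps y; rewrite !inE => /or3P[] /eqP gy; rewrite gy.
- have [] := fixed_next (y - 2); first by rewrite /moved subrK gy eqxx.
  move=> /jE j1 /jE j2.
  have {1}->: y = (y - 2) + 2 by ring.
  rewrite rE j1 (_ : y - 2 + 3 = (y - 2 + 1) + 2); last by ring.
  by rewrite rE j2; ring.
- by rewrite !rE gy rE gy.
- rewrite (_ : y + 3 = y + 1 + 2); last by ring.
  rewrite rE; have /jump_cases/orP[] : jumps n g y by rewrite /jumps gy.
    move=> f2; have [_ /jE ->] := fixed_next _ f2.
    rewrite (_ : y + 1 + 3 = y + 2 + 2); last by ring.
    by rewrite rE fixE.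
  move=> f1; rewrite (fixE _ f1) (_ : y + 1 = y - 1 + 2); last by ring.
  have [] := fixed_next (y - 1); first by rewrite (_ : y - 1 + 2 = y + 1) //; ring.
  by move=> /jE j1 _; rewrite rE j1; ring.
Qed.

Lemma hamiltonian_circuit_perm (T : finType) (e : rel T) (s : seq T) :
  hamiltonian_circuit e s ->
  exists h : {perm T}, (forall x, e x (h x)) /\ (forall x y, y \in porbit h x).
Proof.
case=> /andP[e_s uniq_s] mem_s.
exists (perm (can_inj (prev_next uniq_s))); split=> [x|x y].
  by rewrite permE next_cycle.
have: connect (frel (next s)) x y.
  by rewrite (fconnect_cycle (cycle_next uniq_s)).
move=> /iter_findex <-; set i := findex _ _ _.
have -> : iter i (next s) x = (perm (can_inj (prev_next uniq_s)) ^+ i)%g x.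
  by rewrite permX; apply: eq_iter => z; rewrite permE.
exact: mem_porbit.
Qed.

Theorem theorem3p1 (a : nat) (a_gt0 : (0 < a)%N) (dvd6a : (6 %| a)%N) :
  ~ exists s : seq 'Z_(2 * a)%N,
      hamiltonian_circuit (Cay (2 * a)%N [:: a%:Z; a%:Z + 2; a%:Z + 3]) s.
Proof.
case=> s /hamiltonian_circuit_perm[h [h_arc h_trans]].
have a_ge6 : (6 <= a)%N by exact: dvdn_leq.
have n_gt3 : (3 < 2 * a)%N by lia.
have n_gt1 : (1 < 2 * a)%N by lia.
move: h h_arc h_trans; set n := (2 * a)%N in n_gt3 n_gt1 * => h h_arc h_trans.
pose c : 'Z_n := a%:R.
have cc : c + c = 0.
  by apply/eqP; rewrite -natrD natr_Zp_eq0 // /n mul2n addnn.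
have h_step x : h x \in [:: x + c; x + c + 2; x + c + 3].
  by have := h_arc x; rewrite /Cay /= orbF !intrD -!pmulrn !inE !addrA.
pose g := (h * translation _ c)%g.
have gE x : g x = h x + c by rewrite permM permE.
have g_step x : g x \in [:: x; x + 2; x + 3].
  have xcc y : x + c + y + c = x + y by rewrite -addrA (addrAC x) -!addrA cc addr0 addrC.
  rewrite gE; have := h_step x; rewrite !inE => /or3P[] /eqP ->.
  - by rewrite -addrA cc addr0 eqxx.
  - by rewrite xcc eqxx orbT.
  - by rewrite xcc eqxx !orbT.
have w x := crossings_const n g x n_gt3 g_step.
(* The differences [g x - x - c] are the steps of [h]. If [b] kills them all, the orbit of 0 stays
   in the kernel of multiplication by [b], which misses 1. *)
have inv_absurd (b : nat) : (b < n)%N -> (0 < b)%N ->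
    (forall x, b%:R * (g x - x - c) = 0 :> 'Z_n) -> False.
  move=> b_lt b_gt0 b_inv.
  have : b%:R * 1 == 0 :> 'Z_n.
    apply: (invariant_of_transitive _ _ 0 1 (fun x => b%:R * x == 0) (h_trans 0 1)).
      move=> z /eqP bz; have := b_inv z.
      by rewrite gE (_ : h z + c - z - c = h z - z); [rewrite mulrBr bz subr0 => -> | ring].
    by rewrite mulr0.
  by rewrite mulr1 natr_Zp_eq0 // gtnNdvd.
have c_fixed x : moved n g x || moved n g (x + c).
  apply/negPn; rewrite negb_or !negbK; apply/negP => /andP[/eqP gx /eqP gxc].
  have hx : h x = x + c by rewrite -[LHS]addr0 -cc addrA -gE gx.
  have hxc : h (x + c) = x by rewrite -[LHS]addr0 -cc addrA -gE gxc -addrA cc addr0.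
  (* The swapped pair is closed under [h], yet [x + 1] lies outside it because 1 and [c - 1] are
     nonzero. *)
  have : (x + 1 == x) || (x + 1 == x + c).
    apply: (invariant_of_transitive _ _ x _ (fun z => (z == x) || (z == x + c)) (h_trans x _)).
      by move=> z /pred2P[] ->; rewrite ?hx ?hxc eqxx ?orbT.
    by rewrite eqxx.
  have c1 : c - 1 = a.-1%:R by rewrite -subn1 natrB.
  rewrite (inj_eq (addrI _)) -{2}[x]addr0 (inj_eq (addrI _)) oner_eq0.
  by rewrite eq_sym -subr_eq0 c1 natr_Zp_eq0 // gtnNdvd // /n; lia.
(* Modulo [2 * a], multiplication by [a] kills exactly the even residues, and [c] is one of them. *)
have a2 : a%:R * 2 = 0 :> 'Z_n by rewrite mulr_natr mulr2n.
have ac : a%:R * c = 0.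
  by apply/eqP; rewrite -natrM natr_Zp_eq0 // dvdn_pmul2r //; apply: dvdn_trans dvd6a.
have few_strands : (crossings n g 0%R <= 1)%N -> False.
  move=> w_le1; apply: (inv_absurd a) => [||x]; rewrite /n; try lia.
  rewrite mulrBr ac subr0; have := g_step x; rewrite !inE => /or3P[] /eqP gx.
  - by rewrite gx subrr mulr0.
  - by rewrite gx addrAC subrr add0r.
  have jx : jumps n g x by rewrite /jumps gx.
  have [f2 f1] : ~~ moved n g (x + 2) /\ ~~ moved n g (x + 1).
    by move: w_le1; rewrite -(w x) /crossings jx; do 2!case: (moved _ _ _).
  (* The translates by [c] of the two fixed points are moved, so the translated gap already has two
     strands. *)
  have := w_le1; rewrite -(w (x + c)) /crossings !(addrAC x c).
  by have := c_fixed (x + 2); have := c_fixed (x + 1); rewrite (negbTE f1) (negbTE f2) /= => -> ->.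
case w_val: (crossings n g 0) few_strands => [|[|[|[|k]]]] few_strands.
- exact: few_strands.
- exact: few_strands.
- have := odd_two_strands _ _ n_gt3 g_step w_val; rewrite /g.
  have -> : c = (a./2)%:R + (a./2)%:R.
    by rewrite -natrD addnn halfK (_ : odd a = false) ?subn0 //; lia.
  rewrite odd_permM (negbTE (odd_translation_double _ _)) addbF.
  rewrite (odd_transitive_perm _ _ 0 (h_trans 0)) card_ord Zp_cast //.
  by rewrite /n mul2n odd_double.
- have [b ab] : exists b, a = (3 * b)%N by exists (a %/ 3)%N; lia.
  (* Here [2 * b] is a third of [n], so it kills exactly the multiples of 3. *)
  apply: (inv_absurd (2 * b)%N) => [||x]; rewrite /n; try lia.
  have /eqP -> : jumps n g x.
    by have := w x; rewrite w_val /crossings; do 2!case: (moved _ _ _); case: (jumps _ _ _).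
  rewrite (_ : x + 3 - x - c = 3 - c); last by ring.
  rewrite mulrBr /c -natrM -natrM.
  have n0 m : (n %| m)%N -> m%:R = 0 :> 'Z_n by move=> ?; apply/eqP; rewrite natr_Zp_eq0.
  rewrite !n0 ?subr0 //; first by rewrite /n; apply/dvdnP; exists b; lia.
  by rewrite /n; apply/dvdnP; exists 1%N; lia.
- by move: w_val; rewrite /crossings; do 2!case: (moved _ _ _); case: (jumps _ _ _).
Qed.
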